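(* Let $\mathcal{S}=(X,T,X_0,\to,\Sigma,\ell)$ be a finite-state automaton. If $\mathcal{S}$ is $*$-$K$-delayed strongly detectable for some $K\in\mathbb{N}$, then $\mathcal{S}$ is also $*$-$|X|^2$-delayed strongly detectable.
   Context: A finite-state automaton (FSA) is a sextuple $\mathcal{S}=(X,T,X_0,\to,\Sigma,\ell)$, where $X$ is a finite set of states, $T$ a finite set of events, $X_0\subset X$ a set of initial states, $\to\subset X\times T\times X$ a transition relation, $\Sigma$ a finite set of labels, and $\ell:T\to\Sigma\cup\{\epsilon\}$ a labeling function ($\epsilon$ is the empty word). $\ell$ is extended to finite event sequences by $\ell(t_1\cdots t_n)=\ell(t_1)\cdots\ell(t_n)$, $\ell(\epsilon)=\epsilon$. For $s=t_1\cdots t_n\in T^*$, $x\xrightarrow{s}x'$ means that there are states $x=x_0,x_1,\dots,x_n=x'$ with $(x_{i-1},t_i,x_i)\in\to$ for all $i$ (so $x\xrightarrow{\epsilon}x$). For $\sigma_1,\sigma_2\in\Sigma^*$ define the delayed state estimate $$\mathcal{M}(\mathcal{S},\sigma_1,\sigma_2)=\{x\in X\mid \exists x_0\in X_0,\ \exists x'\in X,\ \exists s_1,s_2\in T^*:\ \ell(s_1)=\sigma_1,\ \ell(s_2)=\sigma_2,\ x_0\xrightarrow{s_1}x\xrightarrow{s_2}x'\}.$$ The language $\mathcal{L}(\mathcal{S})$ is the set of $\sigma\in\Sigma^*$ such that $x_0\xrightarrow{s}x$ for some $x_0\in X_0$, $x\in X$, $s\in T^*$ with $\ell(s)=\sigma$.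 Write $\sigma'\sqsubset\sigma$ if the finite word $\sigma'$ is a prefix of $\sigma$ (possibly equal to $\sigma$). For $K\in\mathbb{N}$, $\mathcal{S}$ is $*$-$K$-delayed strongly detectable if there is $k\in\mathbb{N}$ such that for all $\sigma\in\mathcal{L}(\mathcal{S})$ and all $\sigma_1,\sigma_2\in\Sigma^*$ with $\sigma_1\sigma_2\sqsubset\sigma$: if $|\sigma_1|\ge k$ and $|\sigma_2|\ge K$, then $|\mathcal{M}(\mathcal{S},\sigma_1,\sigma_2)|=1$. *)

(* Defs.v *)
From mathcomp Require Import all_boot.
From mathcomp Require Import boolp.

Set Implicit Arguments.
Unset Strict Implicit.
Unset Printing Implicit Defensive.

(* [label t = None] encodes an unobservable event, i.e. one labelled by the
   empty word. *)
Record fsa : Type := Fsa {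
  state : finType;
  event : finType;
  init : {set state};
  trans : {set state * event * state};
  alphabet : finType;
  label : event -> option alphabet
}.

Section Automaton.
Variable S : fsa.

(* [pmap] drops the unobservable events and concatenates the other labels. *)
Definition label_word (s : seq (event S)) : seq (alphabet S) :=
  pmap (@label S) s.

Fixpoint run (x : state S) (s : seq (event S)) (x' : state S) : Prop :=
  if s is t :: s' then exists y : state S, (x, t, y) \in trans S /\ run y s' x'
  else x = x'.

(* The membership condition is a proposition; [asbool] turns it into a boolean
   classically, so that the estimate is a finite set with a cardinal. *)
Definition delayed_estimate (sigma1 sigma2 : seq (alphabet S)) :
    {set state S} :=
  [set x | `[< exists (x0 x' : state S) (s1 s2 : seq (event S)),
     x0 \in init S /\ label_word s1 = sigma1 /\ label_word s2 = sigma2 /\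
     run x0 s1 x /\ run x s2 x' >]].

Definition language (sigma : seq (alphabet S)) : Prop :=
  exists (x0 x : state S) (s : seq (event S)),
    x0 \in init S /\ run x0 s x /\ label_word s = sigma.

Definition delayed_strongly_detectable (K : nat) : Prop :=
  exists k : nat, forall sigma : seq (alphabet S), language sigma ->
    forall sigma1 sigma2 : seq (alphabet S),
      prefix (sigma1 ++ sigma2) sigma ->
      k <= size sigma1 -> K <= size sigma2 ->
      #|delayed_estimate sigma1 sigma2| = 1.

End Automaton.

(* Main.v *)
Require Import Defs.
From mathcomp Require Import all_boot.
From mathcomp Require Import boolp.

(* Suppose sigma1 is long, |sigma2| >= |X|^2, and x <> y are both in the estimate.
   Record the pairs of states visited by a run from x and a run from y after
   each prefix of sigma2: two of the |X|^2 + 1 pairs coincide, so that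
   sigma2 = u v w where both runs traverse v in a loop. Then x and y both lie in
   the estimate of (sigma1, u v^K), whatever K is, so the system is not
   K-delayed strongly detectable with the same threshold on sigma1. *)

Section WordRuns.
Local Set Implicit Arguments.
Local Unset Strict Implicit.
Variable S : fsa.
Implicit Types (x y z : state S) (u v w : seq (alphabet S)).

(** Hiding the event sequence lets runs be cut and glued along observed words alone, whatever
    unobservable events they contain. *)
Definition word_run x w y : Prop :=
  exists2 s, label_word s = w & run x s y.

Lemma word_run_nil x : word_run x [::] x.
Proof. by exists [::]. Qed.

Lemma run_cat (s1 s2 : seq (event S)) x y z :
  run x s1 y -> run y s2 z -> run x (s1 ++ s2) z.
Proof.
elim: s1 x => [|t s1 IH] x /=; first by move=> ->.
by case=> x1 [tx1 r1] r2; exists x1; split=> //; apply: IH.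
Qed.

Lemma word_run_cat u v x y z :
  word_run x u y -> word_run y v z -> word_run x (u ++ v) z.
Proof.
case=> s1 <- r1 [s2 <- r2]; exists (s1 ++ s2); last exact: run_cat r2.
exact: pmap_cat.
Qed.

(** The cut falls just before the event emitting the first letter of [v], or at the end of the run
    if [v] is empty; unobservable events at the border go to the first part. *)
Lemma word_run_split u v x z :
  word_run x (u ++ v) z -> exists2 y, word_run x u y & word_run y v z.
Proof.
case=> s; elim: s u x => [|t s IH] u x /=.
  by case: u => //= <- <-; exists x; apply: word_run_nil.
rewrite /label_word /=; case lt: (label t) => [a|] /=.
  case: u => [|b u] /=.
    move=> <- [y ty]; exists x; first exact: word_run_nil.
    by exists (t :: s); [rewrite /label_word /= lt | exists y].
  case=> <- /IH{}IH [y [ty /IH[y' [s1 <- r1] r2]]].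
  exists y' => //; exists (t :: s1); first by rewrite /label_word /= lt.
  by exists y.
move=> /IH{}IH [y [ty /IH[y' [s1 <- r1] r2]]].
exists y' => //; exists (t :: s1); first by rewrite /label_word /= lt.
by exists y.
Qed.

Lemma word_run_loop n v x : word_run x v x -> word_run x (flatten (nseq n v)) x.
Proof.
move=> rv; elim: n => [|n IH] /=; first exact: word_run_nil.
exact: word_run_cat IH.
Qed.

(** Here [f i] is a state met after [i] letters along one fixed run, and [take (j - i) (drop i w)]
    is the factor of [w] between positions [i] and [j]. *)
Lemma word_run_trace w x z : word_run x w z ->
  exists2 f : nat -> state S, f 0 = x &
    forall i j, i <= j <= size w ->
      word_run (f i) (take (j - i) (drop i w)) (f j).
Proof.
elim: w x => [|a w IH] x.
  by exists (fun=> x) => // i j _; apply: word_run_nil.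
rewrite -cat1s => /word_run_split[y ra /IH[f f0 fP]].
exists (fun i => if i is i'.+1 then f i' else x) => // -[|i] [|j] //= lij.
- exact: word_run_nil.
- apply: (@word_run_cat [:: a] _ _ y) => //; rewrite -f0.
  by have := fP 0 j lij; rewrite subn0 drop0.
- by rewrite subSS; apply: fP.
Qed.

Lemma delayed_estimateP u v x :
  reflect (exists x0 x', [/\ x0 \in init S, word_run x0 u x & word_run x v x'])
          (x \in delayed_estimate u v).
Proof.
rewrite inE; apply: (iffP (asboolP _)).
  move=> [x0 [x' [s1 [s2 [x0I [<- [<- [r1 r2]]]]]]]].
  by exists x0, x'; split=> //; [exists s1 | exists s2].
move=> [x0 [x' [x0I [s1 <- r1] [s2 <- r2]]]].
by exists x0, x', s1, s2.
Qed.

Lemma delayed_estimate_neq0 w u v :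
  language w -> prefix (u ++ v) w -> delayed_estimate u v != set0.
Proof.
move=> [x0 [x' [s [x0I [r sw]]]]] /prefixP[q def_w].
have : word_run x0 (u ++ v ++ q) x' by exists s => //; rewrite catA -def_w.
case/word_run_split=> x ru /word_run_split[y rv _].
by apply/set0Pn; exists x; apply/delayed_estimateP; exists x0, y.
Qed.

(** Pigeonhole on pairs of states makes both runs loop on the same factor [v]; this is where the
    square comes from. *)
Lemma pair_pumping w x y x' y' :
  #|state S| ^ 2 <= size w -> word_run x w x' -> word_run y w y' ->
  exists u v p q, [/\ 0 < size v, word_run x u p, word_run y u q,
                      word_run p v p & word_run q v q].
Proof.
move=> le_w /word_run_trace[f f0 fP] /word_run_trace[g g0 gP].
(* Positions 0 to |X|^2 all lie within [w] and outnumber the pairs by one. *)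
pose h (i : 'I_(#|state S| ^ 2).+1) := (f i, g i).
have /injectivePn[i0 [j0 nij hij]] : ~~ injectiveb h.
  apply/negP => /injectiveP/leq_card.
  by rewrite card_ord card_prod mulnn ltnn.
wlog ltij : i0 j0 nij hij / i0 < j0.
  move=> WL; case: (ltngtP i0 j0) => [lt|gt|/val_inj eq]; first exact: WL lt.
  - by apply: WL gt => //; rewrite eq_sym.
  - by rewrite eq eqxx in nij.
case: hij => fij gij.
have lejw : j0 <= size w by apply: leq_trans le_w; rewrite -ltnS.
have leiw : i0 <= size w by apply: leq_trans lejw; apply: ltnW.
have bij : i0 <= j0 <= size w by rewrite lejw ltnW.
exists (take i0 w), (take (j0 - i0) (drop i0 w)), (f i0), (g i0); split.
- rewrite size_takel ?subn_gt0 // size_drop.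
  by rewrite leq_sub2r.
- by rewrite -f0; have := fP 0 i0 leiw; rewrite subn0 drop0.
- by rewrite -g0; have := gP 0 i0 leiw; rewrite subn0 drop0.
- by have := fP _ _ bij; rewrite -fij.
- by have := gP _ _ bij; rewrite -gij.
Qed.

End WordRuns.

Theorem corollary2 (S : fsa) :
  (exists K : nat, delayed_strongly_detectable S K) ->
  delayed_strongly_detectable S (#|state S| ^ 2).
Proof.
move=> [K [k detK]]; exists k => sigma Lsigma sigma1 sigma2 pre le1 le2.
(* With one element at hand, only uniqueness remains. *)
have /set0Pn[x xM] := delayed_estimate_neq0 Lsigma pre.
apply/eqP/cards1P; exists x; apply/setP => y; rewrite in_set1.
apply/idP/eqP => [yM|-> //].
have /delayed_estimateP[x0 [x' [x0I rx1 rx2]]] := xM.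
have /delayed_estimateP[y0 [y' [y0I ry1 ry2]]] := yM.
have [u [v [p [q [v0 rxu ryu rpv rqv]]]]] := pair_pumping le2 rx2 ry2.
pose w := u ++ flatten (nseq K v).
have rxw : word_run x w p by apply: word_run_cat rxu _; apply: word_run_loop.
have ryw : word_run y w q by apply: word_run_cat ryu _; apply: word_run_loop.
have Lw : language (sigma1 ++ w).
  by have [s sw r] := word_run_cat rx1 rxw; exists x0, p, s.
(* Each of the [K] copies of [v] contributes at least one letter. *)
have leKw : K <= size w.
  rewrite size_cat size_flatten /shape map_nseq sumn_nseq.
  by apply: leq_trans (leq_addl _ _); apply: leq_pmull.
(* The prefix [sigma1] is unchanged, so the same threshold [k] applies. *)
have /eqP/cards1P[z Mz] := detK _ Lw sigma1 w (prefix_refl _) le1 leKw.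
have : x \in delayed_estimate sigma1 w by apply/delayed_estimateP; exists x0, p.
have : y \in delayed_estimate sigma1 w by apply/delayed_estimateP; exists y0, q.
by rewrite Mz !in_set1 => /eqP-> /eqP->.
Qed.
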